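(* Let $G$ be a Polish group admitting a Lévy net of probability measures converging to invariance with regard to the Monge-Kantorovich distance. Then for every compact $G$-space $X$, every $G$-invariant regular Borel probability measure on $X$ is supported on the set of $G$-fixed points of $X$.
   Context: A compact $G$-space is a compact Hausdorff space with a continuous action of $G$. Measures on compact spaces are regular Borel probability measures. A net $(\nu_\beta)$ of Borel probability measures on a Polish group $G$ is a Lévy net (concentrates) if it does so with respect to the right uniform structure of $G$, whose basic entourages are $\{(x,y)\colon xy^{-1}\in V\}$, $V$ a neighbourhood of the identity. That is: for every net of Borel sets $A_\beta\subseteq G$ (same index set) with $\liminf_\beta\nu_\beta(A_\beta)>0$ and every open neighbourhood $V$ of the identity, $\lim_\beta\nu_\beta(VA_\beta)=1$. For a metric space $(Y,d)$ and Borel probability measures $\mu_1,\mu_2$ on $Y$, the Monge-Kantorovich distance is $d_{MK}(\mu_1,\mu_2)=\inf\int_{Y\times Y}d(x,y)\,d\nu$, the infimum over all Borel probability measures $\nu$ on $Y\times Y$ with marginals $\mu_1,\mu_2$. For $g\in G$ and a measure $\nu$ on $G$, $g\ast\nu$ is the push-forward of $\nu$ under $x\mapsto gx$. A net $(\nu_\beta)$ converges to invariance in the sense of the Monge-Kantorovich distance if, for $d$ a compatible right-invariant metric on $G$, $d_{MK}(g\ast\nu_\beta,\nu_\beta)\to0$ for every $g\in G$. *)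

(* Defs.v *)
From HB Require Import structures.
From mathcomp Require Import all_boot all_order all_algebra.
From mathcomp Require Import all_classical all_reals all_analysis.
Set Implicit Arguments.
Unset Strict Implicit.
Unset Printing Implicit Defensive.
Import Order.TTheory GRing.Theory Num.Theory.
Import numFieldNormedType.Exports.

Local Open Scope classical_set_scope.
Local Open Scope ring_scope.

(* The pointedness of the carriers (here and in [ptopologicalType] below) is
   required by [measurableType]; the chosen point plays no role. *)
HB.structure Definition PreTopologicalGroup :=
  {G of PointedTopological G & Group G}.

HB.mixin Record PreTopologicalGroup_isTopologicalGroup G
    & PreTopologicalGroup G := {
  mulg_continuous : continuous (fun p : G * G => (p.1 * p.2)%g) ;
  invg_continuous : continuous (fun x : G => (x^-1)%g)
}.

#[short(type="topologicalGroupType")]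
HB.structure Definition TopologicalGroup :=
  {G of PreTopologicalGroup G & PreTopologicalGroup_isTopologicalGroup G}.

Section metrics.
Context (R : realType).

Record is_metric (T : Type) (d : T -> T -> R) : Prop := IsMetric {
  is_metric_ge0 : forall x y, 0 <= d x y ;
  is_metric_eq0 : forall x y, d x y = 0 <-> x = y ;
  is_metric_sym : forall x y, d x y = d y x ;
  is_metric_triangle : forall x y z, d x z <= d x y + d y z }.

Definition compatible_metric (T : topologicalType) (d : T -> T -> R) : Prop :=
  is_metric d /\
  forall U : set T, open U <->
    forall x, U x -> exists2 e : R, 0 < e & [set y | d x y < e] `<=` U.

Definition complete_metric (T : topologicalType) (d : T -> T -> R) : Prop :=
  forall u : nat -> T,
    (forall e : R, 0 < e -> exists N : nat, forall m n : nat,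
       (N <= m)%N -> (N <= n)%N -> d (u m) (u n) < e) ->
    exists l : T, u @ \oo --> l.

Definition polish_space (T : topologicalType) : Prop :=
  (exists2 S : set T, countable S & dense S) /\
  (exists2 d : T -> T -> R, compatible_metric d & complete_metric d).

Definition right_invariant (G : groupType) (d : G -> G -> R) : Prop :=
  forall x y g : G, d (x * g)%g (y * g)%g = d x y.

End metrics.

Notation borel T := (g_sigma_algebraType (@open T)).

Definition borel_set (T : ptopologicalType) (A : set T) : Prop :=
  measurable (A : set (borel T)).

Section nets.
Context (I : Type) (le : I -> I -> Prop).

Record directed_set : Prop := DirectedSet {
  directed_set_inhabited : inhabited I ;
  directed_set_refl : forall a, le a a ;
  directed_set_trans : forall a b c, le a b -> le b c -> le a c ;
  directed_set_ub : forall a b, exists2 c, le a c & le b c }.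

Definition tails : set_system I :=
  filter_from [set: I] (fun b => [set c | le b c]).

Definition net_liminf (R : realType) (u : I -> \bar R) : \bar R :=
  ereal_sup (range (fun b => ereal_inf (u @` [set c | le b c]))).

End nets.

Section levy.
Context (R : realType) (G : topologicalGroupType).
Context (I : Type) (le : I -> I -> Prop) (nu : I -> probability (borel G) R).

Definition levy_net : Prop :=
  forall A : I -> set G, (forall b, borel_set (A b)) ->
  (0 < net_liminf le (fun b => nu b (A b)))%E ->
  forall V : set G, open_nbhs (1%g : G) V ->
  nu b [set (v * a)%g | v in V & a in A b] @[b --> tails le] --> 1%E.

End levy.

Section monge_kantorovich.
Context (R : realType) (Y : ptopologicalType).

Definition couplings (mu1 mu2 : set (borel Y) -> \bar R) :
    set (probability (borel (Y * Y)%type) R) :=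
  [set pi | forall A : set Y, borel_set A ->
     pi (fst @^-1` A) = mu1 A /\ pi (snd @^-1` A) = mu2 A].

Definition mk_dist (d : Y -> Y -> R) (mu1 mu2 : set (borel Y) -> \bar R) :
    \bar R :=
  ereal_inf [set (\int[pi]_z (d z.1 z.2)%:E)%E | pi in couplings mu1 mu2].

End monge_kantorovich.

Section invariance.
Context (R : realType) (G : topologicalGroupType).

Definition translate (g : G) (mu : set (borel G) -> \bar R) :
    set (borel G) -> \bar R :=
  pushforward mu (fun x : borel G => (g * x)%g : borel G).

Definition mk_cvg_to_invariance (I : Type) (le : I -> I -> Prop)
    (nu : I -> probability (borel G) R) : Prop :=
  exists d : G -> G -> R, [/\ compatible_metric d, right_invariant d &
    forall g : G,
      mk_dist d (translate g (nu b)) (nu b) @[b --> tails le] --> 0%E].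

End invariance.

Section gspaces.
Context (R : realType) (G : topologicalGroupType) (X : ptopologicalType).

Record continuous_action (act : G -> X -> X) : Prop := ContinuousAction {
  continuous_action1 : forall x, act 1%g x = x ;
  continuous_actionM : forall g h x, act (g * h)%g x = act g (act h x) ;
  continuous_action_cts : continuous (fun p : G * X => act p.1 p.2) }.

Record compact_gspace (act : G -> X -> X) : Prop := CompactGspace {
  compact_gspace_compact : compact [set: X] ;
  compact_gspace_hausdorff : hausdorff_space X ;
  compact_gspace_action : continuous_action act }.

Definition fixed_points (act : G -> X -> X) : set X :=
  [set x | forall g, act g x = x].

Definition invariant_measure (act : G -> X -> X)
    (mu : set (borel X) -> \bar R) : Prop :=
  forall (g : G) (A : set X), borel_set A ->
    pushforward mu (act g : borel X -> borel X) A = mu A.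

(* Meant for Hausdorff [X], where compact sets are closed, hence Borel. *)
Definition regular_measure (mu : set (borel X) -> \bar R) : Prop :=
  forall A : set X, borel_set A ->
    mu A = ereal_inf [set mu U | U in [set U : set X | open U /\ A `<=` U]] /\
    mu A = ereal_sup [set mu K | K in [set K : set X | compact K /\ K `<=` A]].

(* Measurability is included because a [probability] takes unspecified values
   on non-measurable sets. *)
Definition supported_on (mu : probability (borel X) R) (F : set X) : Prop :=
  borel_set F /\ mu F = 1%E.

End gspaces.

(* Main.v *)
Require Import Defs.
From HB Require Import structures.
From mathcomp Require Import all_boot all_order all_algebra.
From mathcomp Require Import all_classical all_reals all_analysis.
From mathcomp Require Import finmap measurable_realfun lra.

(** If an element [g] moves a point [x], continuity of the action and the
    Hausdorff property give neighbourhoods [V] of [1] and [W] of [x] for which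
    [V W] and [V g W] are disjoint ([moved_point_separation]). The theorem
    reduces to showing that [W] is null: inner regularity and compactness then
    give that the open set of all moved points is null
    ([compact_locally_null]).

    Suppose [mu W > 0] and fix [c] strictly between [0] and [mu W]. Write
    [A x] for the open set of those [h] with [h x] in [W]. By Fubini and the
    invariance of [mu], the average over [x] of [nu_b (A x)] is [mu W], so for
    every index [b] some point [x_b] has [nu_b (A x_b) > c]
    ([invariant_measure_orbit_mass]). Put [A_b = A x_b]. Concentration gives
    [nu_b (V A_b) --> 1]. Convergence to invariance also gives mass to
    [V g A_b]: the translate of [nu_b] by [g] gives [g A_b] mass more than
    [c], and it is close to [nu_b] in the Monge-Kantorovich distance, so
    [nu_b] gives a thickening of [g A_b] mass at least [c / 2]
    ([mk_dist_thickening]); right invariance of the metric puts a small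
    enough thickening inside [V g A_b]. Hence [V A_b] and [V g A_b] meet for
    some [b] ([levy_net_meets_translate]). Letting a common element act on
    [x_b] produces a point of both [V W] and [V g W], a contradiction.

    Since [x_b] varies with [b], it matters that the Levy property speaks of
    nets of sets [A_b] and not of a single fixed set. *)

Set Implicit Arguments.
Unset Strict Implicit.
Unset Printing Implicit Defensive.
Import Order.TTheory GRing.Theory Num.Theory.
Import numFieldNormedType.Exports.

(** * Borel sets of product spaces *)

Section borel_sets.
Local Open Scope classical_set_scope.

Lemma open_borel (T : ptopologicalType) (A : set T) : open A -> borel_set A.
Proof. by move=> oA; apply: sub_sigma_algebra. Qed.

Lemma continuous_prod_borel_preimage (T U V : ptopologicalType)
    (f : T * U -> V) (A : set V) : continuous f -> borel_set A ->
  measurable (f @^-1` A : set (borel (T * U)%type)).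
Proof.
move=> /continuousP cf mA; rewrite -[f @^-1` A]setTI.
have mf : measurable_fun setT (f : borel (T * U)%type -> borel V).
  apply: (@measurability _ _ (borel (T * U)%type) (borel V) setT f
    (@open V) erefl) => _ [B oB <-].
  by rewrite setTI; apply: sub_sigma_algebra; exact: cf.
exact: mf.
Qed.

Lemma fst_continuous (T U : topologicalType) : continuous (@fst T U).
Proof. by move=> [t u]; exact: cvg_fst. Qed.

Lemma snd_continuous (T U : topologicalType) : continuous (@snd T U).
Proof. by move=> [t u]; exact: cvg_snd. Qed.

Lemma open_prod_rect (T U : topologicalType) (O : set (T * U)) t u :
  open O -> O (t, u) ->
  exists P Q, [/\ open_nbhs t P, open_nbhs u Q & P `*` Q `<=` O].
Proof.
move=> oO Otu.
have [[P Q] /= [nP nQ] PQO] : nbhs (t, u) O by exact: open_nbhs_nbhs.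
move: nP nQ; rewrite !nbhsE => -[P' oP' sP] [Q' oQ' sQ].
exists P', Q'; split=> // -[a b] [/= P'a Q'b].
by apply: PQO; split; [exact: sP | exact: sQ].
Qed.

Lemma open_section1 (T U : topologicalType) (O : set (T * U)) u :
  open O -> open [set t | O (t, u)].
Proof.
move=> oO; rewrite openE => t /= Otu.
have [P [Q [oP [_ Qu] PQO]]] := open_prod_rect oO Otu.
by apply: filterS (open_nbhs_nbhs oP) => t' Pt'; apply: PQO.
Qed.

Lemma open_section2 (T U : topologicalType) (O : set (T * U)) t :
  open O -> open [set u | O (t, u)].
Proof.
move=> oO; rewrite openE => u /= Otu.
have [P [Q [[_ Pt] oQ PQO]]] := open_prod_rect oO Otu.
by apply: filterS (open_nbhs_nbhs oQ) => u' Qu'; apply: PQO.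
Qed.

(** Fubini's theorem lives on the product of the two Borel sigma-algebras,
    which in general is smaller than the Borel sigma-algebra of the product. A
    countable base on one factor suffices for open sets to belong to it: an
    open [O] is the union, over basic [P], of the rectangles [P `*` W P], where
    [W P] is the largest open set with [P `*` W P] inside [O]. The other factor,
    a compact space in the application, may fail to be second countable. *)
Lemma second_countable_open_prod_measurable (T U : ptopologicalType)
    (O : set (T * U)) :
  @second_countable T -> open O ->
  measurable (O : set (borel T * borel U)).
Proof.
move=> [B cB [oB bB]] oO.
pose W (P : set T) := \bigcup_(Q in [set Q | open Q /\ P `*` Q `<=` O]) Q.
have -> : O = \bigcup_(P in B) (P `*` W P).
  rewrite eqEsubset; split=> [[t u] Otu | [t u] [P BP [/= Pt [Q [oQ]]]]].
    have [P [Q [oP [oQ Qu] PQO]]] := open_prod_rect oO Otu.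
    have [P' [BP' P't] P'P] := bB t P (open_nbhs_nbhs oP).
    exists P' => //; split=> //=; exists Q => //; split=> // -[a b] [P'a Qb].
    by apply: PQO; split=> //; exact: P'P.
  by move=> PQO Qu; apply: PQO.
rewrite bigcup_set_type; apply: countable_bigcupT_measurable => [|P].
  by rewrite (eq_countable (card_setT B)).
have /set_mem BP := valP P.
apply: measurableX; first exact: open_borel (oB _ BP).
by apply: open_borel; apply: bigcup_open => Q [].
Qed.

End borel_sets.

(** * Compatible metrics and the Monge-Kantorovich distance *)

Section metrics.
Local Open Scope classical_set_scope.
Local Open Scope ring_scope.
Context (R : realType).

Lemma open_metric_ball (T : topologicalType) (d : T -> T -> R) x e :
  compatible_metric d -> open [set y | d x y < e].
Proof.
move=> [[d0 deq dsym dtri] dU]; apply/dU => y /= dxy.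
exists (e - d x y); first by lra.
by move=> z /=; have := dtri x y z; lra.
Qed.

Lemma open_metric_thickening (T : topologicalType) (d : T -> T -> R)
    (A : set T) e :
  compatible_metric d -> open [set y | exists2 x, A x & d x y < e].
Proof.
move=> dT; rewrite (_ : [set y | _] = \bigcup_(x in A) [set y | d x y < e]) //.
by apply: bigcup_open => x _; exact: open_metric_ball.
Qed.

Lemma open_metric_lt (T : topologicalType) (d : T -> T -> R) e :
  compatible_metric d -> open [set z : T * T | d z.1 z.2 < e].
Proof.
move=> dT; have [[d0 deq dsym dtri] dU] := dT.
rewrite openE => -[x y] /= dxy; pose r := (e - d x y) / 2.
have r0 : 0 < r by rewrite /r; lra.
have nball z : nbhs z [set y | d z y < r].
  apply: open_nbhs_nbhs; split; first exact: open_metric_ball.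
  by rewrite /= (deq z z).2.
exists ([set x' | d x x' < r], [set y' | d y y' < r]) => //=.
move=> -[x' y'] /= [dx dy].
have := dtri x' x y'; have := dtri x y y'; rewrite (dsym x' x).
by move: dx dy; rewrite /r; lra.
Qed.

Lemma separable_metric_second_countable (T : topologicalType) (d : T -> T -> R)
    (S : set T) :
  compatible_metric d -> countable S -> dense S -> @second_countable T.
Proof.
move=> dT cS dS; have [[d0 deq dsym dtri] dU] := dT.
pose b (p : T * nat) := [set y | d p.1 y < p.2.+1%:R^-1].
exists (b @` (S `*` [set: nat])).
  by apply: sub_countable (card_image_le _ _) _; exact: countableX.
split=> [_ [p _ <-]|x U]; first exact: open_metric_ball.
rewrite nbhsE => -[U' [/dU oU' U'x] U'U].
have [e e0 eU'] := oU' _ U'x.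
have [n] : exists n, 0 + n.+1%:R^-1 < e / 2.
  by apply: ltr_add_invr; rewrite divr_gt0.
rewrite add0r => ne.
have [] := dS [set y | d x y < n.+1%:R^-1].
- by exists x; rewrite /= (deq x x).2// invr_gt0.
- exact: open_metric_ball.
move=> s [/= xs Ss]; exists (b (s, n)).
  by split; [exists (s, n) | rewrite /b /= dsym].
move=> y; rewrite /b /= => sy; apply: U'U; apply: eU' => /=.
by move: (dtri x s y) xs sy ne; set q := _^-1; lra.
Qed.

Local Open Scope ereal_scope.

Lemma metric_measurable (Y : ptopologicalType) (d : Y -> Y -> R) :
  compatible_metric d ->
  measurable_fun [set: borel (Y * Y)%type] (fun z : borel (Y * Y)%type => d z.1 z.2).
Proof.
move=> dY; apply: (@measurability _ _ (borel (Y * Y)%type) R setT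
  (fun z : borel (Y * Y)%type => d z.1 z.2) _
  (RGenInftyO.measurableE R)).
move=> _ [_ [e ->] <-]; rewrite setTI.
apply: sub_sigma_algebra; rewrite (_ : _ @^-1` _ = [set z : Y * Y | (d z.1 z.2 < e)%R]).
  exact: open_metric_lt.
by apply/seteqP; split=> z /=; rewrite in_itv.
Qed.

(** Pick a coupling of cost less than [delta * eta]. By Markov's inequality it
    gives mass at most [eta] to the pairs at distance at least [delta]; every
    other pair whose first entry lies in [A] has its second entry in the
    thickening of [A]. *)
Lemma mk_dist_thickening (Y : ptopologicalType) (d : Y -> Y -> R)
    (mu1 mu2 : set (borel Y) -> \bar R) (delta eta : R) (A : set Y) :
  compatible_metric d -> (0 < delta)%R -> borel_set A ->
  mk_dist d mu1 mu2 < (delta * eta)%:E ->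
  mu1 A <= mu2 [set y | exists2 x, A x & (d x y < delta)%R] + eta%:E.
Proof.
move=> dY delta0 mA /ereal_inf_lt[_ [pi pic <-] pilt].
have [[d0 _ _ _] _] := dY.
set N := [set y | _].
have mN : borel_set N by apply: open_borel; exact: open_metric_thickening.
pose far := [set z : borel (Y * Y)%type | (delta <= d z.1 z.2)%R].
have mfar : measurable far.
  rewrite -[far]setCK; apply: measurableC; apply: sub_sigma_algebra.
  rewrite (_ : ~` far = [set z : Y * Y | (d z.1 z.2 < delta)%R]).
    exact: open_metric_lt.
  apply/seteqP; split=> z /=; rewrite /far /=; first by move/negP; rewrite -ltNge.
  by rewrite leNgt => ->.
have pifar : delta%:E * pi far <= (delta * eta)%:E.
  apply: le_trans (ltW pilt).
  have := @le_integral_comp_abse _ _ R pi setT measurableT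
    (fun z : borel (Y * Y)%type => (d z.1 z.2)%:E) delta idfun.
  rewrite setTI /=.
  have -> : [set x : borel (Y * Y)%type | delta%:E <= `|(d x.1 x.2)%:E|] = far.
    by apply/seteqP; split=> z; rewrite /far /= lee_fin ger0_norm.
  under eq_integral do rewrite /= ger0_norm//.
  apply => //.
    exact: measurable_id.
  by apply/measurable_EFinP; exact: metric_measurable.
have {}pifar : pi far <= eta%:E.
  by move: pifar; rewrite EFinM lee_pmul2l// lte_fin.
have m1 := continuous_prod_borel_preimage (@fst_continuous Y Y) mA.
have m2 := continuous_prod_borel_preimage (@snd_continuous Y Y) mN.
rewrite -(pic A mA).1 -(pic N mN).2.
apply: (@le_trans _ _ (pi (snd @^-1` N `|` far))); last first.
  by apply: le_trans (measureU2 _ _ _) _ => //; exact: leeD2l.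
apply: le_measure; [exact: mem_set | exact/mem_set/measurableU |].
move=> -[x y] /= Ax; case: (ltP (d x y) delta) => dxy; [left|right] => //=.
by exists x.
Qed.

End metrics.

(** * Continuous actions *)

Section group_actions.
Local Open Scope classical_set_scope.
Local Open Scope ereal_scope.
Context (R : realType) (G : topologicalGroupType).

Lemma open_translates (V A : set G) :
  open V -> open [set (v * a)%g | v in V & a in A].
Proof.
move=> oV.
rewrite (_ : [set _ | _ in _ & _ in _] = \bigcup_(a in A) [set z | V (z * a^-1)%g]).
  apply: bigcup_open => a _.
  apply: (@open_section1 _ _ [set p : G * G | V (p.1 * p.2)%g]).
  by move/continuousP: (@mulg_continuous G); apply.
apply/seteqP; split=> [_ [v Vv [a Aa <-]]|z [a Aa /= Vza]].
  by exists a => //=; rewrite mulgK.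
by exists (z * a^-1)%g => //; exists a => //; rewrite mulgVK.
Qed.

Context (X : ptopologicalType) (act : G -> X -> X).
Hypothesis ctsact : continuous_action act.

Lemma open_action_preimage (W : set X) :
  open W -> open [set p : G * X | W (act p.1 p.2)].
Proof. by move/continuousP: (continuous_action_cts ctsact); apply. Qed.

Lemma open_orbit_preimage (W : set X) x : open W -> open [set h | W (act h x)].
Proof. by move=> /open_action_preimage/(@open_section1 _ _ _ x). Qed.

Lemma open_translate_preimage (W : set X) g : open W -> open (act g @^-1` W).
Proof. by move=> /open_action_preimage/(@open_section2 _ _ _ g). Qed.

(** Continuity of the action at [(1, x)] and at [(1, act g x)] spreads
    disjoint neighbourhoods of [x] and [act g x] over small perturbations by
    group elements. *)
Lemma moved_point_separation g x : hausdorff_space X -> act g x <> x ->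
  exists V W, [/\ open_nbhs 1%g V, open_nbhs x W &
    forall u v a b, V u -> V v -> W a -> W b -> act u a <> act v (act g b)].
Proof.
move=> + gx; rewrite open_hausdorff => /(_ x (act g x)) [].
  by apply/eqP => /esym.
move=> [A B] /= [/set_mem Ax /set_mem Bgx] [oA oB /eqP AB0].
have act1 := continuous_action1 ctsact.
have [|V1 [W1 [[oV1 V11] [oW1 W1x] VW1]]] :=
  open_prod_rect (t := 1%g) (u := x) (open_action_preimage oA).
  by rewrite /= act1.
have [|V2 [W2 [[oV2 V21] [oW2 W2gx] VW2]]] :=
  open_prod_rect (t := 1%g) (u := act g x) (open_action_preimage oB).
  by rewrite /= act1.
exists (V1 `&` V2), (W1 `&` act g @^-1` W2); split.
- by split=> //; exact: openI.
- by split=> //; apply: openI => //; exact: open_translate_preimage.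
- move=> u v a b [V1u _] [_ V2v] [W1a _] [_ W2gb] eq.
  have Aua := VW1 (u, a) (conj V1u W1a).
  have Bvb := VW2 (v, act g b) (conj V2v W2gb).
  suff : (A `&` B) (act u a) by rewrite AB0.
  by split=> //; rewrite eq.
Qed.

Lemma closed_fixed_points : hausdorff_space X -> closed (fixed_points act).
Proof.
move=> hX; rewrite -openC openE => x /= /existsNP[g gx].
have [V [W [[_ V1] [oW Wx] VW]]] := moved_point_separation hX gx.
apply: filterS (open_nbhs_nbhs (conj oW Wx)) => y Wy fixy.
by have := VW _ _ _ _ V1 V1 Wy Wy; rewrite (fixy g).
Qed.

(** Integrate the indicator of [act h x] being in [W] in both orders. For fixed
    [h] the integral over [x] is [mu W] by invariance, so [mu W] is the mean over
    [x] of the masses [nu [set h | W (act h x)]], and they cannot all be at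
    most [c]. *)
Lemma invariant_measure_orbit_mass (nu : probability (borel G) R)
    (mu : probability (borel X) R) (W : set X) (c : R) :
  @second_countable G -> invariant_measure act mu -> open W ->
  c%:E < mu W -> exists x, c%:E < nu [set h | W (act h x)].
Proof.
move=> scG invmu oW cW; apply: contrapT => /forallNP nuW.
have mO := second_countable_open_prod_measurable scG (open_action_preimage oW).
have := indic_fubini_tonelli nu mu mO.
rewrite indic_fubini_tonelli_FE// indic_fubini_tonelli_GE//.
have -> : \int[nu]_h (mu \o xsection [set p : G * X | W (act p.1 p.2)]) h = mu W.
  rewrite (eq_integral (cst (mu W))) => [|h _ /=].
    by rewrite integral_cst// [X in _ * X](probability_setT nu) mule1.
  rewrite -(invmu h W (open_borel oW)); congr (mu _).
  by apply/seteqP; split=> y; rewrite xsectionE.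
move=> muW; move: cW; rewrite muW; apply/negP; rewrite -leNgt.
have <- : \int[mu]_x cst c%:E x = c%:E.
  by rewrite integral_cst// [X in _ * X](probability_setT mu) mule1.
apply: ge0_le_integral => //.
- exact: measurable_fun_ysection.
- move=> x _; have := nuW x => /negP; rewrite -leNgt /=.
  by congr (nu _ <= _); apply/seteqP; split=> h; rewrite ysectionE.
Qed.

End group_actions.

(** * Levy nets converging to invariance *)

Section levy_nets.
Local Open Scope classical_set_scope.
Local Open Scope ereal_scope.
Context (R : realType) (G : topologicalGroupType).
Context (I : Type) (le : I -> I -> Prop) (nu : I -> probability (borel G) R).
Hypotheses (dirI : directed_set le) (levynu : levy_net le nu).
Hypothesis invnu : mk_cvg_to_invariance le nu.

Lemma tails_proper : ProperFilter (tails le).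
Proof.
have [[i0] le_refl le_trans le_ub] := dirI.
apply: filter_from_proper => [|i _]; last by exists i => /=.
apply: filter_from_filter => [|i j _ _]; first by exists i0.
have [k ik jk] := le_ub i j.
by exists k => // l /= kl; split; [exact: le_trans kl | exact: le_trans kl].
Qed.

(** The sets [V A_b] and [V g A_b] meet for some [b], as their masses add up to
    more than [1]: eventually the first has mass more than [1 - c / 2] by
    concentration, and the second has mass at least [c / 2] by approximate
    invariance. *)
Lemma levy_net_meets_translate (A : I -> set G) (c : R) (V : set G) g :
  (forall b, open (A b)) -> (0 < c)%R -> (forall b, c%:E <= nu b (A b)) ->
  open_nbhs 1%g V ->
  exists b u v a a', [/\ V u, V v, A b a, A b a' & (u * a = v * (g * a'))%g].
Proof.
move=> oA c0 cA oV; have [oV' V1] := oV; apply: contrapT => noVA.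
have PF := tails_proper.
have [d [dG dright dcvg]] := invnu.
have [[d0 deq dsym dtri] dU] := dG.
have [delta delta0 dV] := (dU V).1 oV' _ V1.
pose VA b := [set (v * a)%g | v in V & a in A b].
pose gA b : set G := [set h | A b (g^-1 * h)%g].
pose N b : set G := [set y | exists2 x, gA b x & (d x y < delta)%R].
have ogA b : open (gA b).
  apply: (@open_section2 _ _ [set p : G * G | A b (p.1 * p.2)%g]).
  by move/continuousP: (@mulg_continuous G); apply.
have : 0 < net_liminf le (fun b => nu b (A b)).
  have [[i0] _ _ _] := dirI.
  apply: (@lt_le_trans _ _ c%:E); first by rewrite lte_fin.
  apply: le_trans (ereal_sup_ubound (imageT _ i0)).
  by apply: le_ereal_inf_tmp => _ [b _ <-].
move=> /(levynu (fun b => open_borel (oA b)))/(_ V oV) cvgVA.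
have c20 : (0 < c / 2)%R by rewrite divr_gt0.
have evVA : \forall b \near tails le, (1 - c / 2)%:E < nu b (VA b).
  apply: (cvgVA [set y | (1 - c / 2)%:E < y]); apply: open_nbhs_nbhs.
  by split; [exact: open_ereal_gt_ereal | rewrite /= lte_fin gtrBl].
have evN : \forall b \near tails le,
    mk_dist d (translate g (nu b)) (nu b) < (delta * (c / 2))%:E.
  apply: (dcvg g [set y | y < (delta * (c / 2))%:E]); apply: open_nbhs_nbhs.
  by split; [exact: open_ereal_lt_ereal | rewrite /= lte_fin mulr_gt0].
have [b [bVA bN]] := filter_ex (filterI evVA evN).
have := mk_dist_thickening dG delta0 (open_borel (ogA b)) bN.
have -> : translate g (nu b) (gA b) = nu b (A b).
  rewrite /translate /pushforward; congr (nu b _).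
  by apply/seteqP; split=> h; rewrite /gA /= mulKg.
rewrite -/(N b) => AN.
have mVA : borel_set (VA b) by apply: open_borel; exact: open_translates.
have mN : borel_set (N b) by apply: open_borel; exact: open_metric_thickening.
have VAN : VA b `&` N b = set0.
  apply/seteqP; split=> // _ [[u Vu [a Aa <-]] [y gAy dy]]; apply: noVA.
  exists b, u, (u * a * y^-1)%g, a, (g^-1 * y)%g; split=> //.
    (* Right translation by [y] carries the pair [(1, u a y^-1)] to [(y, u a)]. *)
    by apply: dV => /=; rewrite -(dright _ _ y) mulgVK mul1g.
  by rewrite mulVKg mulgVK.
have : nu b (VA b) + nu b (N b) <= 1.
  rewrite -measureU//; apply: probability_le1; exact: measurableU.
have finN := fin_num_measure (nu b) _ mN.
have finVA := fin_num_measure (nu b) _ mVA.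
move: (cA b) AN bVA; rewrite /= -(fineK finN) -(fineK finVA).
move=> /le_trans h /h; rewrite -!EFinD lee_fin lte_fin.
by rewrite lee_fin; lra.
Qed.

Context (X : ptopologicalType) (act : G -> X -> X).
Context (mu : probability (borel X) R).

(** If [W] had positive mass, an element common to [V A_b] and [V g A_b], where
    [A_b] collects the [h] with [act h (y b)] in [W], would bring [y b] into
    both [V W] and [V g W], contradicting [moved_point_separation]. *)
Lemma levy_net_moved_point_null g x :
  @second_countable G -> hausdorff_space X -> continuous_action act ->
  invariant_measure act mu -> act g x <> x ->
  exists2 W, open_nbhs x W & mu W = 0.
Proof.
move=> scG hX ctsact invmu gx.
have [V [W [oV [oW Wx] VW]]] := moved_point_separation ctsact hX gx.
exists W => //; apply/eqP; rewrite eq_le measure_ge0 andbT leNgt.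
apply/negP => muW0.
have finW := fin_num_measure mu _ (open_borel oW).
pose c := (fine (mu W) / 2)%R.
have W0 : (0 < fine (mu W))%R by rewrite -lte_fin fineK.
have c0 : (0 < c)%R by rewrite divr_gt0.
have cW : c%:E < mu W by rewrite -(fineK finW) lte_fin /c; lra.
have /choice[y cy] (b : I) : exists y, c%:E < nu b [set h | W (act h y)].
  exact: (invariant_measure_orbit_mass ctsact (nu b) scG invmu oW cW).
have [|b|b [u [v [a [a' [Vu Vv Aa Aa' eq]]]]]] :=
    @levy_net_meets_translate (fun b => [set h | W (act h (y b))]) c V g _ c0 _ oV.
- by move=> b; exact: (open_orbit_preimage ctsact (y b) oW).
- exact: ltW.
- apply: (VW u v _ _ Vu Vv Aa Aa').
  by rewrite -!(continuous_actionM ctsact) eq mulgA.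
Qed.

End levy_nets.

(** * Null sets and the fixed points *)

Section null_sets.
Local Open Scope classical_set_scope.
Local Open Scope ereal_scope.

(** Local nullity alone gives nothing for an uncountable union of null open
    sets; compactness is what reduces it to a finite union. *)
Lemma compact_locally_null (R : realType) (X : ptopologicalType)
    (mu : probability (borel X) R) (K : set X) :
  borel_set K -> compact K ->
  (forall x, K x -> exists2 W, open_nbhs x W & mu W = 0) -> mu K = 0.
Proof.
move=> mK; rewrite compact_cover => cK nullK.
have [|x Kx|D DO KD] := cK (set X) [set W | open W /\ mu W = 0] id.
- by move=> W [].
- by have [W [oW Wx] W0] := nullK x Kx; exists W.
have DO' W : [set` D] W -> open W /\ mu W = 0 by move=> /DO/set_mem.
apply/eqP; rewrite eq_le measure_ge0 andbT.
have -> : 0 = \sum_(W \in [set` D]) mu W by rewrite fsbig1// => W /DO'[].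
apply: content_sub_fsum => // W /DO'[oW _]; exact: open_borel.
Qed.

End null_sets.

Unset Implicit Arguments.
Set Strict Implicit.

Theorem theorem5p7 (R : realType) (G : topologicalGroupType)
    (polishG : polish_space R G)
    (levyG : exists (I : Type) (le : I -> I -> Prop)
        (nu : I -> probability (borel G) R),
      [/\ directed_set le, levy_net le nu & mk_cvg_to_invariance le nu])
    (X : ptopologicalType) (act : G -> X -> X)
    (gspaceX : compact_gspace act)
    (mu : probability (borel X) R) (regular_mu : regular_measure mu)
    (invariant_mu : invariant_measure act mu) :
  supported_on mu (fixed_points act).
Proof.
have [_ hX ctsact] := gspaceX.
have [[S cS dS] [d dG _]] := polishG.
have scG := separable_metric_second_countable dG cS dS.
have [I [le [nu [dirI levynu invnu]]]] := levyG.
have cF := closed_fixed_points ctsact hX.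
have oM : open (~` fixed_points act)%classic by rewrite openC.
have mM := open_borel oM.
have mF : borel_set (fixed_points act).
  by rewrite -(setCK (fixed_points act)); exact: measurableC.
split=> //; rewrite -(setCK (fixed_points act)) probability_setC//.
suff -> : mu (~` fixed_points act)%classic = 0%E by rewrite sube0.
apply/eqP; rewrite eq_le measure_ge0 andbT (regular_mu _ mM).2.
apply: ge_ereal_sup => _ [K [cK KM] <-].
rewrite (compact_locally_null (mu := mu))//.
  have /open_borel : open (~` K)%classic by rewrite openC; exact: compact_closed.
  by move=> /measurableC; rewrite setCK.
move=> x /KM /= /existsNP[g gx].
exact: (levy_net_moved_point_null dirI levynu invnu scG hX ctsact invariant_mu gx).
Qed.
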